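(* Let $n,k,d$ be integers with $1\le k\le n-1$ and $d\ge 2$, and let $\mathcal{T}_d^{(n,k)}$ be the class of trees with boundary having $n$ vertices, exactly $k$ of them interior, such that every interior vertex has degree at least $d$. A tree $G\in\mathcal{T}_d^{(n,k)}$ has the Faber-Krahn property in $\mathcal{T}_d^{(n,k)}$ if and only if $G$ is an SLO$^\ast$-tree in which one interior vertex has degree $d^\circ=d+\sum_{v\in V_0}(d_v-d)$ and all other interior vertices have degree $d$ (here $d_v$ denotes the degree of $v$ in $G$; note $\sum_{v\in V_0}d_v=n+k-2$ for every tree in the class). Such a $G$ is uniquely determined up to isomorphism.
   Context: A tree with boundary is a finite tree $G=(V,E)$ whose vertex set is partitioned into the set $\partial V$ of boundary vertices, which are exactly the vertices of degree $1$, and the set $V_0$ of interior vertices, which are exactly the vertices of degree at least $2$; both sets are nonempty. The Dirichlet operator $\Delta_0$ is the principal submatrix of the graph Laplacian $D-A$ of $G$ (degrees taken in $G$) indexed by $V_0$; $\lambda(G)$ is its smallest eigenvalue. $G$ has the Faber-Krahn property in a class $\mathcal{C}\ni G$ if $\lambda(G)\le\lambda(H)$ for all $H\in\mathcal{C}$. For a tree with a chosen root $v_0$, the height of $v$ is $h(v)=\mathrm{dist}(v,v_0)$; if $v,w$ are adjacent and $h(w)=h(v)+1$, then $v$ is the parent of $w$ and $w$ a child of $v$. A total order $\prec$ on $V$ is spiral-like (SLO) for root $v_0$ if for all vertices: (S1) $v\prec w$ implies $h(v)\le h(w)$; (S2) if $v_1\prec v_2$ then every child of $v_1$ precedes every child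 of $v_2$; (S3) if $v\prec w$ and $v\in\partial V$ then $w\in\partial V$. It is an SLO$^\ast$-ordering if additionally (S4) for interior vertices $v\prec w$ implies $d_v\le d_w$. An SLO$^\ast$-tree is a tree with boundary admitting an SLO$^\ast$-ordering for some root. *)

(* Defs.v *)
From HB Require Import structures.
From mathcomp Require Import all_boot all_order all_algebra.
From mathcomp Require Import fingroup perm reals.
Set Implicit Arguments.
Unset Strict Implicit.
Unset Printing Implicit Defensive.
Import Order.TTheory GRing.Theory Num.Theory.

Section Trees.
Variable n : nat.
Notation V := 'I_n.

Definition simple_graph (e : rel V) : Prop :=
  (forall x y, e x y = e y x) /\ (forall x, ~~ e x x).

Definition deg (e : rel V) (v : V) : nat := #|[set w | e v w]|.

Definition connected_graph (e : rel V) : Prop := forall x y, connect e x y.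

Definition acyclic (e : rel V) : Prop :=
  ~ exists (x : V) (p : seq V), [/\ uniq (x :: p), 2 <= size p & path.cycle e (x :: p)].

Definition is_tree (e : rel V) : Prop :=
  [/\ simple_graph e, connected_graph e & acyclic e].

Definition boundary (e : rel V) : {set V} := [set v | deg e v == 1].
Definition interior (e : rel V) : {set V} := [set v | 2 <= deg e v].

Definition tree_with_boundary (e : rel V) : Prop :=
  [/\ is_tree e, (forall v, 1 <= deg e v),
      boundary e != set0 & interior e != set0].

Definition in_class (k d : nat) (e : rel V) : Prop :=
  [/\ tree_with_boundary e, #|interior e| = k &
      forall v, v \in interior e -> d <= deg e v].

(* Graph Laplacian D - A and Dirichlet operator (principal submatrix on V_0,
   indexed by 'I_#|V_0| via the enumeration of V_0). *)
Definition laplacian (R : nzRingType) (e : rel V) : 'M[R]_n :=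
  \matrix_(i, j) (if i == j then (deg e i)%:R else if e i j then -1 else 0)%R.

Definition dirichlet (R : nzRingType) (e : rel V) : 'M[R]_#|interior e| :=
  \matrix_(i, j) laplacian R e (enum_val i) (enum_val j).

Definition is_lambda (R : realType) (e : rel V) (l : R) : Prop :=
  eigenvalue (dirichlet R e) l /\
  (forall m : R, eigenvalue (dirichlet R e) m -> (l <= m)%R).

Definition faber_krahn (R : realType) (k d : nat) (e : rel V) : Prop :=
  forall e' : rel V, in_class k d e' ->
    forall l l' : R, is_lambda e l -> is_lambda e' l' -> (l <= l')%R.

Fixpoint ball (e : rel V) (x : V) (m : nat) : {set V} :=
  if m is m'.+1 then
    ball e x m' :|: [set y | [exists z in ball e x m', e z y]]
  else [set x].

Definition dist (e : rel V) (x y : V) : nat :=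
  find (fun m => y \in ball e x m) (iota 0 n).

Definition height (e : rel V) (v0 v : V) : nat := dist e v v0.

Definition child (e : rel V) (v0 v w : V) : bool :=
  e v w && (height e v0 w == (height e v0 v).+1).

Definition strict_total_order (prec : rel V) : Prop :=
  [/\ (forall x, ~~ prec x x),
      (forall x y z, prec x y -> prec y z -> prec x z) &
      (forall x y, x != y -> prec x y || prec y x)].

Definition SLO (e : rel V) (v0 : V) (prec : rel V) : Prop :=
  [/\ strict_total_order prec,
   (* S1 *) (forall v w, prec v w -> height e v0 v <= height e v0 w),
   (* S2 *) (forall v1 v2 w1 w2, prec v1 v2 -> child e v0 v1 w1 ->
                child e v0 v2 w2 -> prec w1 w2) &
   (* S3 *) (forall v w, prec v w -> v \in boundary e -> w \in boundary e)].

Definition SLOstar (e : rel V) (v0 : V) (prec : rel V) : Prop :=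
  SLO e v0 prec /\
  (* S4 *) (forall v w, v \in interior e -> w \in interior e ->
               prec v w -> deg e v <= deg e w).

Definition SLOstar_tree (e : rel V) : Prop :=
  tree_with_boundary e /\ exists (v0 : V) (prec : rel V), SLOstar e v0 prec.

Definition extremal_degrees (d : nat) (e : rel V) : Prop :=
  exists2 u, u \in interior e &
    deg e u = d + \sum_(v in interior e) (deg e v - d) /\
    forall v, v \in interior e -> v != u -> deg e v = d.

Definition graph_iso (e e' : rel V) : Prop :=
  exists f : {perm V}, forall x y, e' (f x) (f y) = e x y.

End Trees.

(* Main.v *)
Require Import Defs.
From HB Require Import structures.
From mathcomp Require Import all_boot all_order all_algebra.
From mathcomp Require Import reals.
From mathcomp Require Import fingroup perm zify ring.
From mathcomp Require boolp topology normedtype derive.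

(** For a nonnegative [f] vanishing on the boundary, the Dirichlet form is
    [sum_v d_v f(v)^2 - 2 sum_(uv) f(u) f(v)].  Writing [f] as a nonnegative combination
    of indicators of its superlevel sets turns it into a nonnegative combination of
    numbers of edges leaving [A] from a subset [C], for superlevel sets [C <= A].  In a
    tree of the class at least [d|C| + 2 - |A| - |C|] edges do so, since at most
    [|C| - 1 + |A| - 1] (ordered) edges join [C] to [A].  In the tree filled in
    breadth-first order all these bounds are attained by the initial segments of the
    order, so it minimises the Rayleigh quotient.

    If a tree [G] attains the minimum, its positive ground state [f] is also a ground state
    of the breadth-first tree, along any enumeration of the vertices by decreasing [f].
    Testing both eigenvector equations against indicators shows that the bound is attained
    whenever [A] is a superlevel set and [C] a superlevel set to which part of the next
    level may have been added.  Attained bounds force the degrees of [C], and the parents of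
    the vertices of [A] to lie in [C]; hence children of vertices with larger [f] have
    larger [f], and breadth-first search with siblings sorted by [f] is an SLO*-ordering. *)

Set Implicit Arguments.
Unset Strict Implicit.
Unset Printing Implicit Defensive.
Import Order.TTheory GRing.Theory Num.Theory.

(* Elaborating [{set 'I_n}] inserts this coercion; unless [/=] removes it, [lia] takes
   convertible cardinals for different unknowns. *)
Local Arguments reverse_coercion {T' T} x' x /.

(** * Rooted trees *)

Section ParentMaps.
Variable T : finType.
Implicit Types (e : rel T) (r u v w : T) (A B C : {set T}) (par : T -> T) (h : T -> nat).

Definition parent_edge r par : rel T := fun u v => (v != r) && (par v == u).

Definition rooted_at e r par h : Prop :=
  (forall v, v != r -> h (par v) < h v) /\
  (forall u v, e u v = parent_edge r par u v || parent_edge r par v u).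

Definition offspring r par A : {set T} := [set v | (v != r) && (par v \in A)].

Lemma rooted_ind e r par h (P : T -> Prop) : rooted_at e r par h ->
  P r -> (forall v, v != r -> P (par v) -> P v) -> forall v, P v.
Proof.
case=> hpar _ Pr Ppar v; have [m] := ubnP (h v); elim: m v => // m IH v hv.
have [->//|vr] := eqVneq v r; apply: (Ppar _ vr); apply: IH.
exact: leq_trans (hpar v vr) hv.
Qed.

Definition edges e A B : nat := \sum_(u in A) \sum_(v in B) e u v.

Lemma sum_parent_edge r par A B :
  \sum_(u in A) \sum_(w in B) parent_edge r par u w = #|offspring r par A :&: B|.
Proof.
rewrite exchange_big /= setIC -sum1_card big_mkcond [RHS]big_mkcond /=.
apply: eq_bigr => w _; rewrite !inE; case: (w \in B) => //=.
rewrite /parent_edge; have [|_] := eqVneq w r; first by rewrite big1.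
have [parA|parNA] := boolP (par w \in A).
  by rewrite (bigD1 (par w)) //= eqxx big1 // => u /andP[_]; rewrite eq_sym => /negPf->.
by rewrite big1 // => u uA; case: eqP => // parE; rewrite parE uA in parNA.
Qed.

Lemma rooted_edges e r par h A B : rooted_at e r par h ->
  edges e A B = #|offspring r par A :&: B| + #|offspring r par B :&: A|.
Proof.
case=> hpar eE; rewrite -!sum_parent_edge [in RHS]addnC exchange_big addnC /=.
rewrite -big_split; apply: eq_bigr => u _; rewrite -big_split /=; apply: eq_bigr => v _.
rewrite eE; case: (boolP (parent_edge _ _ _ _)) => [/andP[vr /eqP uE]|//].
case: (boolP (parent_edge _ _ _ _)) => [/andP[ur /eqP vE]|//].
by have := hpar u ur; rewrite vE ltnNge ltnW // -{1}uE hpar.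
Qed.

Lemma edges_in_le e r par h A C : rooted_at e r par h -> r \in C -> C \subset A ->
  edges e C A + #|A :\ r :\: offspring r par C| + 2 <= #|A| + #|C|.
Proof.
move=> rooted rC /subsetP sCA; rewrite (rooted_edges _ _ rooted).
have rA := sCA r rC; rewrite (cardsD1 r A) (cardsD1 r C) rA rC.
rewrite -(cardsID (offspring r par C) (A :\ r)).
have -> : offspring r par C :&: A = (A :\ r) :&: offspring r par C.
  by apply/setP => w; rewrite !inE; case: (w == r); rewrite ?andbF //= andbC.
have : #|offspring r par A :&: C| <= #|C :\ r|.
  by apply/subset_leq_card/subsetP => w; rewrite !inE => /andP[/andP[-> _] ->].
by lia.
Qed.

End ParentMaps.

Section Heights.
Variable n : nat.
Notation V := 'I_n.
Implicit Types (e : rel V) (r v w x y : V).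

Lemma ballP e x m y :
  reflect (exists p, [/\ path e x p, last x p = y & size p <= m]) (y \in Defs.ball e x m).
Proof.
elim: m y => [|m IH] y /=.
  rewrite inE; apply: (iffP eqP) => [->|[[|z p] [_ /= <-]]] //.
  by exists [::].
rewrite inE; apply: (iffP orP) => [[/IH[p [pathp lastp sizep]]|]|].
- by exists p; split=> //; apply: leqW.
- rewrite inE => /existsP[z /andP[/IH[p [pathp lastp sizep]] ezy]].
  by exists (rcons p y); rewrite rcons_path last_rcons size_rcons pathp lastp.
case=> p [+ + +]; case/lastP: p => [_ /= <- _|p z].
  by left; apply/IH; exists [::].
rewrite rcons_path last_rcons size_rcons ltnS => /andP[pathp ez] <- sizep.
right; rewrite inE; apply/existsP; exists (last x p); rewrite ez andbT.
by apply/IH; exists p.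
Qed.

Variables (e : rel V) (r : V).
Hypothesis conn : connected_graph e.

Lemma root_in_ball v : r \in Defs.ball e v (height e r v).
Proof.
have /connectP[p pathp lastp] := conn v r.
case/shortenP: pathp lastp => q pathq uniqq _ lastq.
have sizeq : size q < n.
  by have := card_uniqP uniqq; have := max_card (mem (v :: q)); rewrite card_ord /= => + <-.
have in_range : has (fun m => r \in Defs.ball e v m) (iota 0 n).
  by apply/hasP; exists (size q); [rewrite mem_iota | apply/ballP; exists q; split].
have := nth_find 0 in_range; rewrite nth_iota ?add0n //.
by rewrite has_find size_iota in in_range.
Qed.

Lemma height_le v m : r \in Defs.ball e v m -> height e r v <= m.
Proof.
move=> r_ball; rewrite leqNgt; apply/negP => lt_m.
have := before_find 0 lt_m; rewrite nth_iota ?add0n ?r_ball //.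
by apply: leq_trans lt_m _; rewrite -[X in _ <= X](size_iota 0 n) find_size.
Qed.

Lemma height_eq0 v : (height e r v == 0) = (v == r).
Proof.
apply/eqP/eqP => [h0|->]; last first.
  by apply/eqP; rewrite -leqn0; apply: height_le; rewrite /= inE.
by have := root_in_ball v; rewrite h0 /= inE => /eqP.
Qed.

Lemma height_adj v w : e v w -> height e r v <= (height e r w).+1.
Proof.
move=> evw; have /ballP[p [pathp lastp sizep]] := root_in_ball w.
by apply: height_le; apply/ballP; exists (w :: p); split=> //=; rewrite evw.
Qed.

Lemma closer_neighbor v : v != r ->
  exists2 w, e v w & height e r v = (height e r w).+1.
Proof.
move=> vr; have /ballP[[|w p] [/= pathp lastp sizep]] := root_in_ball v.
  by rewrite lastp eqxx in vr.
case/andP: pathp => evw pathp; exists w => //.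
apply/eqP; rewrite eqn_leq height_adj //=; apply: leq_ltn_trans sizep.
by apply: height_le; apply/ballP; exists p.
Qed.

End Heights.

Section RootedTrees.
Variable n : nat.
Notation V := 'I_n.
Implicit Types (e t : rel V) (r u v w x y : V) (A B C : {set V}) (par : V -> V).

Lemma rooted_par_edge e r par h v : rooted_at e r par h -> v != r -> e v (par v).
Proof. by case=> _ eE vr; rewrite eE /parent_edge vr eqxx orbT. Qed.

Lemma rooted_simple e r par h : rooted_at e r par h -> simple_graph e.
Proof.
case=> hpar eE; split=> [u v|v]; first by rewrite !eE orbC.
rewrite eE orbb negb_and; have [//|/hpar] := eqVneq v r.
by apply: contraTneq => ->; rewrite ltnn.
Qed.

Lemma rooted_connected e r par h : rooted_at e r par h -> connected_graph e.
Proof.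
move=> rooted; have [sym _] := rooted_simple rooted.
have to_root v : connect e v r.
  apply: (rooted_ind (P := fun v => connect e v r) rooted) v => [|v vr]; first exact: connect0.
  by apply: connect_trans; apply/connect1/(rooted_par_edge rooted).
move=> x y; apply: connect_trans (to_root x) _.
by rewrite (sym_connect_sym sym).
Qed.

(* Both neighbours on a cycle of a vertex of maximal height would be its parent. *)
Lemma rooted_acyclic e r par h : rooted_at e r par h -> acyclic e.
Proof.
move=> rooted; have [sym _] := rooted_simple rooted; have [hpar eE] := rooted.
case=> x [p [uniqp sizep cyclep]].
have [z z_in z_max] : exists2 z, z \in x :: p & forall y, y \in x :: p -> h y <= h z.
  have x_in : x \in x :: p by rewrite mem_head.
  by case: (arg_maxnP (P := [in x :: p]) h x_in) => z z_in z_max; exists z.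
have [i q rotE] := rot_to z_in.
have cycleq : path.cycle e (z :: q) by rewrite -rotE rot_cycle.
have uniqq : uniq (z :: q) by rewrite -rotE rot_uniq.
have sizeq : 2 <= size q by move: (congr1 size rotE) sizep; rewrite size_rot /= => -[->].
have nbr_par y : y \in q -> e z y -> y = par z.
  move=> y_in; rewrite eE => /orP[/andP[yr /eqP par_y]|/andP[_ /eqP//]].
  have := hpar y yr; rewrite par_y ltnNge z_max //.
  by rewrite -(mem_rot i) rotE inE y_in orbT.
case: q {rotE} sizeq cycleq uniqq nbr_par => [|a [|b q]] //= _.
case/and3P=> eza _ pathq /and3P[_ a_notin _] nbr_par.
have aE := nbr_par a (mem_head _ _) eza.
move: pathq a_notin; rewrite rcons_path => /andP[_ e_last].
have := nbr_par (last b q); rewrite inE mem_last orbT -aE sym => /(_ isT e_last) <-.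
by rewrite mem_last.
Qed.

Lemma rooted_is_tree e r par h : rooted_at e r par h -> is_tree e.
Proof.
move=> rooted; split; first exact: rooted_simple rooted.
  exact: rooted_connected rooted.
exact: rooted_acyclic rooted.
Qed.

Lemma acyclic_connected_subrel e t : simple_graph e -> acyclic e ->
  subrel t e -> connected_graph t -> t =2 e.
Proof.
move=> [sym irr] acyc te conn u v; apply/idP/idP => [/te//|euv].
apply: contraT => not_tuv; case: acyc.
have /connectP[p pathp lastp] := conn u v.
case/shortenP: pathp lastp => q pathq uniqq _ lastq.
exists u, q; split=> //; last by rewrite /= rcons_path -lastq (sub_path te) //= sym.
case: q pathq uniqq lastq => [|a [|b q]] //= pathq _ lastq.
  by move: euv; rewrite lastq (negPf (irr u)).
by move: pathq; rewrite -lastq andbT (negPf not_tuv).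
Qed.

Lemma tree_rooted e r : is_tree e -> exists par, rooted_at e r par (height e r).
Proof.
case=> e_simple conn acyc; have [sym _] := e_simple.
pose par v := odflt v [pick w | e v w && (height e r v == (height e r w).+1)].
have parP v : v != r -> e v (par v) /\ height e r v = (height e r (par v)).+1.
  move=> vr; rewrite /par; case: pickP => [w /andP[-> /eqP]//|no_parent].
  by have [w ew /eqP hw] := closer_neighbor conn vr; have := no_parent w; rewrite ew hw.
pose t u v := parent_edge r par u v || parent_edge r par v u.
have rooted : rooted_at t r par (height e r) by split=> // v /parP[_ ->].
have te : subrel t e.
  by move=> u v /orP[]/andP[/parP[+ _] /eqP <-]; rewrite // sym.
exists par; split=> [v /parP[_ ->]//|u v].
by rewrite -(acyclic_connected_subrel e_simple acyc te (rooted_connected rooted)).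
Qed.

Lemma rooted_height e r par : rooted_at e r par (height e r) ->
  forall v, v != r -> height e r v = (height e r (par v)).+1.
Proof.
move=> rooted v vr; apply/eqP; rewrite eqn_leq.
rewrite (height_adj r (rooted_connected rooted)) ?(rooted_par_edge rooted) //.
by case: rooted => -> .
Qed.

Lemma rooted_height_root e r par h : rooted_at e r par h -> height e r r = 0.
Proof. by move/rooted_connected=> conn; apply/eqP; rewrite height_eq0. Qed.

Lemma rooted_child e r par : rooted_at e r par (height e r) ->
  child e r =2 parent_edge r par.
Proof.
move=> rooted u w; rewrite /child; have [_ ->] := rooted.
apply/andP/idP => [[/orP[//|/andP[ur /eqP <-]] /eqP]|].
  by rewrite [height e r u](rooted_height rooted ur); lia.
by case/andP=> wr /eqP <-; rewrite (rooted_height rooted wr) /parent_edge wr eqxx.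
Qed.

Lemma rooted_par_interior e r par h : rooted_at e r par h -> r \in interior e ->
  forall w, w != r -> par w \in interior e.
Proof.
case=> hpar eE r_int w wr; have [->//|pr] := eqVneq (par w) r.
rewrite inE /deg; have <- : #|[set w; par (par w)]| = 2.
  rewrite cards2; have [wE|//] := eqVneq w (par (par w)).
  by have := ltn_trans (hpar _ pr) (hpar _ wr); rewrite -wE ltnn.
apply/subset_leq_card/subsetP => x; rewrite !inE eE /parent_edge => /orP[/eqP->|/eqP->].
  by rewrite wr eqxx.
by rewrite pr eqxx orbT.
Qed.

Lemma interiorNboundary e : tree_with_boundary e ->
  forall v, (v \in boundary e) = (v \notin interior e).
Proof. by case=> _ deg1 _ _ v; rewrite !inE -leqNgt eqn_leq deg1 andbT. Qed.

End RootedTrees.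

(** * Edge counts *)

Section EdgeCounts.
Variable n : nat.
Notation V := 'I_n.
Implicit Types (e : rel V) (r u v w x y : V) (A B C : {set V}) (par : V -> V).

Lemma degE e v : deg e v = \sum_w e v w.
Proof.
rewrite /deg -sum1_card big_mkcond; apply: eq_bigr => w _.
by rewrite inE; case: (e v w).
Qed.

Lemma edges_setT e A : edges e A setT = \sum_(u in A) deg e u.
Proof. by apply: eq_bigr => u _; rewrite degE; apply: eq_bigl => w; rewrite inE. Qed.

Lemma edges_setC e A B : edges e A B + edges e A (~: B) = \sum_(u in A) deg e u.
Proof.
rewrite -big_split; apply: eq_bigr => u _ /=; rewrite degE [RHS](bigID [in B]) /=.
by congr (_ + _); apply: eq_bigl => w; rewrite inE.
Qed.

Lemma rooted_degree_sum e r par h A : rooted_at e r par h ->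
  \sum_(u in A) deg e u = #|offspring r par A| + #|A :\ r|.
Proof.
move=> rooted; rewrite -edges_setT (rooted_edges _ _ rooted) setIT; congr (_ + _).
by apply: eq_card => w; rewrite !inE andbT.
Qed.

Lemma interior_boundary_edges e : tree_with_boundary e ->
  edges e (interior e) (~: interior e) = n - #|interior e|.
Proof.
case=> e_is_tree _ _ /set0Pn[r r_int]; have [par rooted] := tree_rooted r e_is_tree.
have par_int := rooted_par_interior rooted r_int.
have -> : edges e (interior e) (~: interior e) = #|~: interior e|; last first.
  by rewrite -[X in X - _](card_ord n) -(cardsC (interior e)) addKn.
rewrite (rooted_edges _ _ rooted) [#|_ :&: interior e|]eq_card0 => [|w]; last first.
  by rewrite in_setI [_ \in offspring _ _ _]in_set in_setC; case: eqVneq => //= /par_int->.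
rewrite addn0; apply: eq_card => w; rewrite in_setI [_ \in offspring _ _ _]in_set in_setC.
by have [->|/par_int->] := eqVneq w r; rewrite ?r_int ?andbT.
Qed.

End EdgeCounts.

Section DegreeBounds.
Variables (n k d : nat) (e : rel 'I_n).
Notation V := 'I_n.
Implicit Types (r u v w : V) (A B C : {set V}).
Hypothesis e_class : in_class k d e.

Lemma degree_sum_ge C : C \subset interior e -> d * #|C| <= \sum_(u in C) deg e u.
Proof.
have [_ _ dmin] := e_class; move/subsetP => sC; rewrite mulnC -sum_nat_const.
by apply: leq_sum => u /sC; apply: dmin.
Qed.

Lemma class_simple : simple_graph e.
Proof. by have [[[e_simple _ _] _ _ _] _ _] := e_class. Qed.

Lemma class_rooted r : exists par, rooted_at e r par (height e r).
Proof. by have [[e_is_tree _ _ _] _ _] := e_class; apply: tree_rooted. Qed.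

Lemma edges_out_ge_rooted r par h A C : rooted_at e r par h ->
  r \in C -> C \subset A -> A \subset interior e ->
  d * #|C| + 2 + #|A :\ r :\: offspring r par C| <= edges e C (~: A) + (#|A| + #|C|).
Proof.
move=> rooted rC sCA sA; have := edges_in_le rooted rC sCA; have := edges_setC e C A.
by have := degree_sum_ge (subset_trans sCA sA) => /=; lia.
Qed.

Lemma edges_out_ge A C : C != set0 -> C \subset A -> A \subset interior e ->
  d * #|C| + 2 <= edges e C (~: A) + (#|A| + #|C|).
Proof.
move=> /set0Pn[r rC] sCA sA; have [par rooted] := class_rooted r.
exact: leq_trans (leq_addr _ _) (edges_out_ge_rooted rooted rC sCA sA).
Qed.

Definition tight C A : Prop := edges e C (~: A) + (#|A| + #|C|) = d * #|C| + 2.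

Lemma tight_parent r par h A C w : rooted_at e r par h ->
  r \in C -> C \subset A -> A \subset interior e -> tight C A ->
  w \in A -> w != r -> par w \in C.
Proof.
move=> rooted rC sCA sA tightCA wA wr; apply: contraT => par_w.
have := edges_out_ge_rooted rooted rC sCA sA; rewrite tightCA.
have : 0 < #|A :\ r :\: offspring r par C|.
  by apply/card_gt0P; exists w; rewrite !inE (negPf par_w) andbF wr.
by lia.
Qed.

Lemma tight_degree A C u : C \subset A -> A \subset interior e -> tight C A ->
  u \in C -> deg e u = d.
Proof.
move=> sCA sA tightCA uC; have [par rooted] := class_rooted u.
have sC := subset_trans sCA sA; have [_ _ dmin] := e_class.
have := degree_sum_ge (subset_trans (subD1set C u) sC).
have := edges_in_le rooted uC sCA; have := edges_setC e C A; have := dmin u (subsetP sC u uC).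
rewrite (big_setD1 u uC) /=; move: tightCA; rewrite /tight (cardsD1 u C) uC.
by rewrite add1n mulnS /=; lia.
Qed.

End DegreeBounds.

(** * Orders on the vertices *)

Section VertexOrders.
Variable n : nat.
Notation V := 'I_n.
Implicit Types (u v w : V) (A C : {set V}) (prec : rel V) (rho : {perm V}).

Definition ord_prefix c : {set V} := [set i : V | i < c].

Lemma card_ord_prefix c : c <= n -> #|ord_prefix c| = c.
Proof.
move=> cn; rewrite -sum1_card (eq_bigl (fun i : V => i < c)) => [|i]; last by rewrite inE.
by rewrite -(big_ord_widen n (fun=> 1)) // sum_nat_const card_ord muln1.
Qed.

Lemma strict_total_order_inj (disp : Order.disp_t) (T : orderType disp) (f : V -> T) :
  injective f -> strict_total_order (fun u v => (f u < f v)%O).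
Proof.
move=> f_inj; split=> [u|u v w|u v uv]; first by rewrite ltxx.
  exact: lt_trans.
by rewrite -neq_lt (inj_eq f_inj).
Qed.

Lemma strict_total_rank prec : strict_total_order prec ->
  exists rho, forall u v, (rho u < rho v) = prec u v.
Proof.
case=> irr trans tot; pose below u := [set w | prec w u].
have below_proper u v : prec u v -> #|below u| < #|below v|.
  move=> uv; apply: proper_card; apply/properP; split.
    by apply/subsetP => w; rewrite !inE => /trans; apply.
  by exists u; rewrite inE // irr.
have below_lt u v : (#|below u| < #|below v|) = prec u v.
  apply/idP/idP => [ltuv|/below_proper//].
  have [uv|/tot/orP[//|/below_proper]] := eqVneq u v; first by rewrite uv ltnn in ltuv.
  by rewrite ltnNge ltnW.
have below_n u : #|below u| < n.
  rewrite -[X in _ < X](card_ord n) -cardsT; apply: proper_card.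
  by apply/properP; split; [exact: subsetT | exists u; rewrite inE // irr].
have rank_inj : injective (fun u => Ordinal (below_n u)).
  move=> u v [cardE]; apply/eqP; apply: contraT => /tot.
  by rewrite -!below_lt cardE ltnn.
by exists (perm rank_inj) => u v; rewrite !permE below_lt.
Qed.

Definition initial rho c : {set V} := rho @^-1: ord_prefix c.

Lemma in_initial rho c v : (v \in initial rho c) = (rho v < c).
Proof. by rewrite !inE. Qed.

Lemma initialS rho c b : c <= b -> initial rho c \subset initial rho b.
Proof. by move=> cb; apply/subsetP => v; rewrite !in_initial => /leq_trans; apply. Qed.

Lemma card_initial rho c : c <= n -> #|initial rho c| = c.
Proof. by move=> cn; rewrite card_preimset ?card_ord_prefix //; apply: perm_inj. Qed.

Lemma perm_downset rho C : (forall u v, rho u < rho v -> v \in C -> u \in C) ->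
  C = initial rho #|C|.
Proof.
move=> down; apply/setP => v; rewrite in_initial; apply/idP/idP => [vC|].
  rewrite -[X in X <= _](card_initial rho (ltn_ord (rho v))).
  apply/subset_leq_card/subsetP => u; rewrite in_initial ltnS leq_eqVlt.
  by case/orP => [/eqP/val_inj/perm_inj->//|/down]; apply.
apply: contraLR => vNC; rewrite -leqNgt.
rewrite -[X in _ <= X](card_initial rho (ltnW (ltn_ord (rho v)))).
apply/subset_leq_card/subsetP => u uC; rewrite in_initial ltnNge leq_eqVlt.
by apply: contra vNC => /orP[/eqP/val_inj/perm_inj->//|/down->].
Qed.

Section Weights.
Context {disp : Order.disp_t} {T : orderType disp}.
Variable f : V -> T.

Definition upper_set C : Prop := forall u v, u \in C -> v \notin C -> (f v <= f u)%O.

Definition superlevel A : Prop := forall u v, u \in A -> v \notin A -> (f v < f u)%O.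

Definition antitone rho : Prop := forall u v, rho u <= rho v -> (f v <= f u)%O.

Lemma superlevel_upper A : superlevel A -> upper_set A.
Proof. by move=> supA u v uA vA; apply/ltW/supA. Qed.

Lemma superlevel_prefix rho A : antitone rho -> superlevel A ->
  A = initial rho #|A|.
Proof.
move=> anti supA; apply: perm_downset => u v uv vA.
by apply: contraT => /(supA _ _ vA); rewrite ltNge anti // ltnW.
Qed.

Lemma sorting_perm C : upper_set C ->
  exists2 rho, antitone rho & C = initial rho #|C|.
Proof.
move=> upC; pose triple v : T^d *l bool *l V := (f v, v \notin C, v).
have triple_inj : injective triple by move=> u v [].
have [rho rhoE] := strict_total_rank (strict_total_order_inj triple_inj).
have rho_lt u v : rho u < rho v ->
    (f v <= f u)%O && ((f u <= f v)%O ==> (v \in C) ==> (u \in C)).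
  rewrite rhoE Order.ProdLexiOrder.ltEprodlexi Order.ProdLexiOrder.leEprodlexi /= !leEdual.
  by case/andP=> /andP[-> ]; case: (f u <= f v)%O; case: (u \in C); case: (v \in C).
exists rho => [u v|].
  by rewrite leq_eqVlt => /orP[/eqP/val_inj/perm_inj->//|/rho_lt/andP[]].
apply: perm_downset => u v /rho_lt/andP[_ /implyP fuv] vC; apply: contraT => uNC.
by have := fuv (upC _ _ vC uNC); rewrite vC (negPf uNC).
Qed.

End Weights.
End VertexOrders.

(** * The canonical extremal tree *)

(* The parameters for which the class of trees is not empty. *)
Definition admissible (n k d : nat) : bool := [&& 0 < k, 2 <= d & d * k + 2 <= n + k].

Lemma class_admissible n k d (e : rel 'I_n) : 2 <= d -> in_class k d e -> admissible n k d.
Proof.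
move=> d_ge2 e_class; have [e_tree card_int _] := e_class; have [_ _ _ int_neq0] := e_tree.
have := edges_out_ge e_class int_neq0 (subxx _) (subxx _).
rewrite interior_boundary_edges // card_int /admissible d_ge2 -card_int card_gt0 int_neq0.
have : #|interior e| <= n by rewrite -[X in _ <= X]card_ord max_card.
by rewrite /=; lia.
Qed.

(* The parent of [i] in the tree filled in breadth-first order: the root [0] takes [d]
   children and every other interior vertex [d - 1], except that the last one, [k - 1],
   takes all the remaining vertices.  The truncated [i - 2] accounts for the additional
   child [1] of the root. *)
Definition canon_par (k d i : nat) : nat := minn ((i - 2) %/ d.-1) k.-1.

Lemma canon_par_ltE k d i c : 2 <= d -> 0 < c < k ->
  (canon_par k d i < c) = (i + c < d * c + 2).
Proof.
case: d => [|[|d]] // _ /andP[c_gt0 ck]; rewrite /canon_par gtn_min ltn_divLR //=.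
have -> : k.-1 < c = false by lia.
by rewrite orbF !mulSn mulnC; case: (c) c_gt0 => // c' _; lia.
Qed.

Lemma canon_par_unique k d i m : 2 <= d -> m < k ->
  (forall c, 0 < c < k -> (m < c) = (i + c < d * c + 2)) -> m = canon_par k d i.
Proof.
move=> d_ge2 mk mP.
have par_lt : canon_par k d i < k by rewrite /canon_par; lia.
have m_lt c : 0 < c < k -> (m < c) = (canon_par k d i < c).
  by move=> ck; rewrite canon_par_ltE // mP.
by have := m_lt m; have := m_lt (canon_par k d i); rewrite !ltnn; lia.
Qed.

Section CanonicalTree.
Variables n k d : nat.
Hypothesis adm : admissible n k d.
Notation V := 'I_n.

Definition canon : rel V := fun i j =>
  ((j != 0 :> nat) && (canon_par k d j == i)) || ((i != 0 :> nat) && (canon_par k d i == j)).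

Let k_gt0 : 0 < k. Proof. by case/and3P: adm. Qed.
Let d_ge2 : 2 <= d. Proof. by case/and3P: adm. Qed.
Let size_ge : d * k + 2 <= n + k. Proof. by case/and3P: adm. Qed.

Lemma admissible_ltn : k < n.
Proof. by have := leq_mul2r k 2 d; rewrite d_ge2 orbT; lia. Qed.
Let k_lt : k < n. Proof. exact: admissible_ltn. Qed.

Lemma canon_par_bound i : canon_par k d i < n.
Proof. by rewrite /canon_par; lia. Qed.

Definition canon_root : V := Ordinal (ltn_trans k_gt0 k_lt).
Definition canon_parent (i : V) : V := Ordinal (canon_par_bound i).

Lemma canon_rooted : rooted_at canon canon_root canon_parent val.
Proof.
split=> // v; rewrite -val_eqE /= /canon_par -lt0n => v_gt0.
by have := leq_div (v - 2) d.-1; lia.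
Qed.

Definition canon_reach c : nat := if c < k then d * c + 2 - c else n.

Lemma canon_reach_le c : canon_reach c <= n.
Proof.
rewrite /canon_reach; case: ltnP => // ck; have := leq_mul2l d.-1 c k.
by case: d d_ge2 size_ge => // d' _; rewrite !mulSn (ltnW ck) orbT /=; lia.
Qed.

Lemma canon_offspring c : 0 < c ->
  offspring canon_root canon_parent (ord_prefix n c) =
  ord_prefix n (canon_reach c) :\ canon_root.
Proof.
move=> c_gt0; apply/setP => w; rewrite !inE /canon_reach; congr (_ && _) => /=.
case: (ltnP c k) => ck; first by rewrite canon_par_ltE ?c_gt0 //; lia.
by rewrite ltn_ord /canon_par; lia.
Qed.

Lemma canon_degree_sum c : 0 < c <= n ->
  \sum_(u in ord_prefix n c) deg canon u = canon_reach c + c - 2.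
Proof.
move=> /andP[c_gt0 cn]; rewrite (rooted_degree_sum _ canon_rooted) canon_offspring //.
have card_pred m : 0 < m <= n -> #|ord_prefix n m :\ canon_root| = m.-1.
  case/andP=> m_gt0 mn; have := cardsD1 canon_root (ord_prefix n m).
  by rewrite card_ord_prefix // inE /= m_gt0; lia.
have reach_gt1 : 2 <= canon_reach c.
  by have := leq_pmull c (ltnW d_ge2); rewrite /canon_reach; case: (ltnP c k); lia.
rewrite !card_pred ?c_gt0 ?cn ?canon_reach_le //; lia.
Qed.

Lemma canon_deg (i : V) :
  deg canon i = if i.+1 < k then d else if i < k then n + k - 2 - d * k.-1 else 1.
Proof.
have iP : i \in ord_prefix n i.+1 by rewrite inE.
have := canon_degree_sum (ltn_ord i : 0 < i.+1 <= n); rewrite (big_setD1 i iP) /=.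
have -> : ord_prefix n i.+1 :\ i = ord_prefix n i.
  by apply/setP => u; rewrite !inE ltnS [RHS]ltn_neqAle.
have := leq_pmull i (ltnW d_ge2); have := leq_pmull i.+1 (ltnW d_ge2).
have [i0|i_gt0] := posnP i.
  rewrite [\sum_(u in _) _]big_pred0 => [|u]; last by rewrite inE i0.
  rewrite /canon_reach i0; case: (ltnP 1 k) => k1; first by lia.
  by have -> : k.-1 = 0 by [lia]; rewrite k_gt0 muln0; lia.
rewrite canon_degree_sum ?i_gt0 ?(ltnW (ltn_ord i)) // /canon_reach mulnS.
case: (ltnP i.+1 k) => [ik|ki]; first by rewrite (ltnW ik); lia.
by have [ik|ik] := ltnP i k; [have -> : k.-1 = i | ]; lia.
Qed.

Lemma canon_interior : interior canon = ord_prefix n k.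
Proof.
apply/setP => i; rewrite !inE canon_deg; case: (ltnP i.+1 k) => [ik|ki].
  by rewrite d_ge2 ltnW.
case: (ltnP i k) => // ik; have := size_ge; have -> : k = i.+1 by lia.
by rewrite mulnS /=; lia.
Qed.

Lemma canon_in_class : in_class k d canon.
Proof.
have root_int : canon_root \in interior canon by rewrite canon_interior inE.
split; last first.
- move=> v; rewrite canon_interior inE canon_deg => vk; rewrite vk.
  case: ltnP => // kv; have := size_ge; have -> : k = v.+1 by lia.
  by rewrite mulnS /=; lia.
- by rewrite canon_interior card_ord_prefix // ltnW.
split.
- exact: rooted_is_tree canon_rooted.
- move=> v; have [vk|kv] := ltnP v k.
    have : v \in interior canon by rewrite canon_interior inE.
    by rewrite inE => /ltnW.
  by rewrite canon_deg !ltnNge kv leqW.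
- apply/set0Pn; exists (Ordinal k_lt); rewrite inE canon_deg /= !ltnNge leqnn.
  by rewrite leqnSn.
- by apply/set0Pn; exists canon_root.
Qed.

Lemma canon_edges_out c b : 0 < c < k -> c <= b <= k ->
  edges canon (ord_prefix n c) (~: ord_prefix n b) = d * c + 2 - (b + c).
Proof.
case/andP=> c_gt0 ck /andP[cb bk]; rewrite (rooted_edges _ _ canon_rooted).
rewrite canon_offspring // [#|_ :&: ord_prefix n c|]eq_card0 => [|w]; last first.
  rewrite !inE /= -leqNgt; apply/negP => /andP[/andP[w0 bw] wc].
  by have [/(_ w w0) /=] := canon_rooted; lia.
have := canon_reach_le c; rewrite /canon_reach ck => reach_le.
rewrite addn0; transitivity #|ord_prefix n (d * c + 2 - c) :\: ord_prefix n b|.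
  by apply: eq_card => w; rewrite !inE -val_eqE /=; lia.
rewrite cardsD card_ord_prefix //.
have -> : ord_prefix n (d * c + 2 - c) :&: ord_prefix n b = ord_prefix n (minn (d * c + 2 - c) b).
  by apply/setP => w; rewrite !inE leq_min.
by rewrite card_ord_prefix; lia.
Qed.

End CanonicalTree.

Arguments canon : clear implicits.

(** * Extremal SLO*-trees are canonical *)

Definition relabel n (rho : {perm 'I_n}) (e : rel 'I_n) : rel 'I_n :=
  fun x y => e (rho x) (rho y).

Section SLOstarTrees.
Variables (n k d : nat) (e : rel 'I_n).
Notation V := 'I_n.
Variables (r : V) (prec : rel V) (par : V -> V) (rho : {perm V}).
Hypotheses (d_ge2 : 2 <= d) (e_class : in_class k d e).
Hypothesis slo : SLOstar e r prec.
Hypothesis deg_extremal : extremal_degrees d e.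
Hypothesis rooted : rooted_at e r par (height e r).
Hypothesis rhoE : forall u v, (rho u < rho v) = prec u v.
Implicit Types (u v w x y : V).

Let adm : admissible n k d := class_admissible d_ge2 e_class.

Lemma SLO_rank_eq0 v : (rho v == 0 :> nat) = (v == r).
Proof.
have [[_ height_mono _ _] _] := slo.
have root_down u w : rho u < rho w -> w \in [set r] -> u \in [set r].
  rewrite rhoE !inE => /height_mono + /eqP wr; rewrite wr.
  by rewrite (rooted_height_root rooted) leqn0 height_eq0 //; apply: rooted_connected rooted.
have /setP/(_ v) := perm_downset root_down.
by rewrite cards1 inE in_initial ltnS leqn0.
Qed.

Lemma SLO_rank_root : rho r = 0 :> nat.
Proof. by apply/eqP; rewrite SLO_rank_eq0. Qed.

Lemma SLO_interior : interior e = initial rho k.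
Proof.
have [[_ _ _ boundary_last] _] := slo; have [e_tree <- _] := e_class.
apply: perm_downset => u v; rewrite rhoE => uv; apply: contraTT.
by rewrite -!interiorNboundary //; apply: boundary_last.
Qed.

Lemma SLO_root_interior : r \in interior e.
Proof. by rewrite SLO_interior in_initial SLO_rank_root; case/and3P: adm. Qed.

Lemma SLOstar_degree v : (rho v).+1 < k -> deg e v = d.
Proof.
move=> vk; have [_ deg_mono] := slo; have [_ _ dmin] := e_class.
have [u u_int [_ deg_others]] := deg_extremal.
have v_int : v \in interior e by rewrite SLO_interior in_initial ltnW.
have [vu|] := eqVneq v u; last exact: deg_others.
have k1n : k.-1 < n by have := admissible_ltn adm; lia.
pose z := rho^-1%g (Ordinal k1n); have zE : rho z = k.-1 :> nat by rewrite permKV.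
have z_int : z \in interior e by rewrite SLO_interior in_initial zE; lia.
have vz : prec v z by rewrite -rhoE zE; lia.
have zu : z != u by rewrite -vu; apply: contraTneq vz => ->; rewrite -rhoE ltnn.
by apply/eqP; rewrite eqn_leq dmin // andbT -(deg_others z) // deg_mono.
Qed.

Lemma SLOstar_offspring c : 0 < c < k ->
  r |: offspring r par (initial rho c) = initial rho (d * c + 2 - c).
Proof.
case/andP=> c_gt0 ck; set C := initial rho c.
have [[_ _ child_mono _] _] := slo.
have cardC : #|C| = c by rewrite card_initial //; have := admissible_ltn adm; lia.
have rC : r \in C by rewrite in_initial SLO_rank_root.
have card_offspring : #|r |: offspring r par C| = d * c + 2 - c.
  have := rooted_degree_sum C rooted.
  rewrite (eq_bigr (fun=> d)) => [|u]; last first.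
    by rewrite in_initial => uc; apply: SLOstar_degree; lia.
  rewrite sum_nat_const cardC cardsU1 !inE eqxx /=.
  by have := cardsD1 r C; rewrite rC cardC mulnC /=; lia.
rewrite -card_offspring; apply: perm_downset => u v uv.
rewrite ![_ \in r |: _]in_setU1; have [->|ur] /= := eqVneq u r; first by [].
case/orP=> [|/[!(inE, in_initial)]/andP[vr par_v]].
  by rewrite -SLO_rank_eq0 => /eqP v0; rewrite v0 in uv.
rewrite ur /=; apply: leq_ltn_trans par_v; rewrite leqNgt rhoE; apply/negP => par_lt.
have := child_mono _ _ v u par_lt; rewrite !(rooted_child rooted) /parent_edge vr ur !eqxx.
by move=> /(_ isT isT); rewrite -rhoE ltnNge ltnW.
Qed.

Lemma SLOstar_parent_rank w : w != r -> rho (par w) = canon_par k d (rho w) :> nat.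
Proof.
move=> wr; apply: canon_par_unique => // [|c ck].
  have := rooted_par_interior rooted SLO_root_interior wr.
  by rewrite SLO_interior in_initial.
have /setP/(_ w) := SLOstar_offspring ck.
by rewrite !(inE, in_initial) (negPf wr) /= => ->; lia.
Qed.

Lemma SLOstar_relabel : e = relabel rho (canon n k d).
Proof.
apply/boolp.funext => x; apply/boolp.funext => y; have [_ ->] := rooted.
rewrite /parent_edge /relabel /canon !SLO_rank_eq0.
have parE u v : (u != r) && (par u == v) = (u != r) && (canon_par k d (rho u) == rho v).
  have [//|ur] := eqVneq u r; rewrite /= -SLOstar_parent_rank //.
  by rewrite val_eqE (inj_eq perm_inj).
by rewrite !parE.
Qed.

End SLOstarTrees.

Lemma SLOstar_tree_canon n k d (e : rel 'I_n) : 2 <= d -> in_class k d e ->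
  SLOstar_tree e -> extremal_degrees d e ->
  exists rho : {perm 'I_n}, e = relabel rho (canon n k d).
Proof.
move=> d_ge2 e_class [_ [r [prec slo]]] deg_extremal.
have [rho rhoE] : exists rho : {perm 'I_n}, forall u v, (rho u < rho v) = prec u v.
  by apply: strict_total_rank; case: slo => -[].
have [par rooted] := class_rooted e_class r.
by exists rho; apply: (SLOstar_relabel d_ge2 e_class slo deg_extremal rooted rhoE).
Qed.

(** * The Dirichlet form and its Rayleigh quotient *)

Section DirichletForm.
Variables (R : realFieldType) (T : finType).
Implicit Types (e : rel T) (u v w : T) (f g h : T -> R) (A C : {set T}) (a l : R).
Local Open Scope ring_scope.

Definition lap e f u : R := \sum_v (e u v)%:R * (f u - f v).
Definition dot f g : R := \sum_u f u * g u.
Definition dform e f g : R := dot f (lap e g).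
Definition indic A u : R := (u \in A)%:R.

Definition supported A f : Prop := forall v, v \notin A -> f v = 0.

Definition positive_exactly_on A f : Prop := forall v, (0 < f v) = (v \in A).

Definition rayleigh_bound A e l : Prop :=
  forall g, supported A g -> l * dot g g <= dform e g g.

Definition ground_state A e l f : Prop :=
  [/\ supported A f, 0 < dot f f, dform e f f = l * dot f f & rayleigh_bound A e l].

Lemma dotC f g : dot f g = dot g f.
Proof. by apply: eq_bigr => u _; rewrite mulrC. Qed.

Lemma dot_ge0 f : 0 <= dot f f.
Proof. by apply: sumr_ge0 => u _; rewrite -expr2 sqr_ge0. Qed.

Lemma dot_eq0 f : dot f f = 0 -> forall u, f u = 0.
Proof.
move=> ff0 u; apply/eqP; rewrite -sqrf_eq0 expr2; apply/eqP.
by apply: (psumr_eq0P _ ff0) => // v _; rewrite -expr2 sqr_ge0.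
Qed.

Lemma dot_gt0 f v : f v != 0 -> 0 < dot f f.
Proof.
move=> fv; rewrite lt_neqAle dot_ge0 andbT eq_sym.
by apply: contra_neq fv => /dot_eq0.
Qed.

Lemma dot_indic v g : dot (indic [set v]) g = g v.
Proof.
rewrite /dot (bigD1 v) //= /indic set11 mul1r big1 ?addr0 // => u /negPf uv.
by rewrite inE uv mul0r.
Qed.

Lemma dot_linl a f g h : dot (fun u => f u + a * g u) h = dot f h + a * dot g h.
Proof. by rewrite /dot mulr_sumr -big_split; apply: eq_bigr => u _ /=; ring. Qed.

Lemma dot_linr a f g h : dot h (fun u => f u + a * g u) = dot h f + a * dot h g.
Proof. by rewrite !(dotC h) dot_linl. Qed.

Lemma lap_lin e a f g : lap e (fun u => f u + a * g u) = fun u => lap e f u + a * lap e g u.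
Proof.
apply: boolp.funext => u; rewrite /lap mulr_sumr -big_split.
by apply: eq_bigr => v _ /=; ring.
Qed.

Lemma dform_linl e a f g h :
  dform e (fun u => f u + a * g u) h = dform e f h + a * dform e g h.
Proof. exact: dot_linl. Qed.

Lemma dform_linr e a f g h :
  dform e h (fun u => f u + a * g u) = dform e h f + a * dform e h g.
Proof. by rewrite /dform lap_lin dot_linr. Qed.

Lemma dform_scale e a f :
  dform e (fun u => a * f u) (fun u => a * f u) = a ^+ 2 * dform e f f.
Proof.
rewrite /dform /dot mulr_sumr; apply: eq_bigr => u _; rewrite /lap !mulr_sumr.
by apply: eq_bigr => v _; ring.
Qed.

Lemma dot_scale a f : dot (fun u => a * f u) (fun u => a * f u) = a ^+ 2 * dot f f.
Proof. by rewrite /dot mulr_sumr; apply: eq_bigr => u _; ring. Qed.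

Lemma dform_sumr (I : finType) e (a : I -> R) (F : I -> T -> R) h :
  dform e h (fun v => \sum_i a i * F i v) = \sum_i a i * dform e h (F i).
Proof.
rewrite /dform /dot; under [RHS]eq_bigr do rewrite mulr_sumr.
rewrite [RHS]exchange_big; apply: eq_bigr => u _ /=.
transitivity (h u * \sum_i a i * lap e (F i) u); last first.
  by rewrite mulr_sumr; apply: eq_bigr => i _; ring.
congr (_ * _); rewrite /lap; under [RHS]eq_bigr do rewrite mulr_sumr.
rewrite [RHS]exchange_big; apply: eq_bigr => v _ /=.
by rewrite -sumrB mulr_sumr; apply: eq_bigr => i _; ring.
Qed.

Lemma dformC e f g : symmetric e -> dform e f g = dform e g f.
Proof.
move=> sym; rewrite /dform /dot /lap; apply/eqP; rewrite -subr_eq0 -sumrB.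
under eq_bigr => u _ do rewrite !mulr_sumr -sumrB.
have -> : \sum_u \sum_v (f u * ((e u v)%:R * (g u - g v)) - g u * ((e u v)%:R * (f u - f v)))
   = \sum_u \sum_v (e u v)%:R * (g u * f v) - \sum_u \sum_v (e u v)%:R * (f u * g v).
  by rewrite -sumrB; apply: eq_bigr => u _; rewrite -sumrB; apply: eq_bigr => v _; ring.
rewrite subr_eq0; apply/eqP; rewrite exchange_big /=; apply: eq_bigr => u _.
by apply: eq_bigr => v _; rewrite sym; ring.
Qed.

Lemma dform_indic e A C : C \subset A -> dform e (indic C) (indic A) = (edges e C (~: A))%:R.
Proof.
move/subsetP => sCA; rewrite /dform /dot /edges natr_sum [RHS]big_mkcond.
apply: eq_bigr => u _; rewrite {1}/indic; case: ifP => uC; last by rewrite mul0r.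
rewrite mul1r /lap natr_sum [RHS]big_mkcond; apply: eq_bigr => v _.
by rewrite /indic (sCA u uC) inE; case: (v \in A); rewrite /= ?subrr ?subr0 ?mulr0 ?mulr1.
Qed.

Lemma supported_indic A C : C \subset A -> supported A (indic C).
Proof.
by move/subsetP => sCA v vA; rewrite /indic (negPf (contra (sCA v) vA)).
Qed.

Lemma supported_lin A a f g : supported A f -> supported A g ->
  supported A (fun u => f u + a * g u).
Proof. by move=> supp_f supp_g v vA; rewrite supp_f // supp_g // mulr0 addr0. Qed.

(* First variation: [t |-> dform (f + t h) - l |f + t h|^2] is minimal at [0]. *)
Lemma ground_state_variation A e l f h : symmetric e -> ground_state A e l f ->
  supported A h -> dform e h f = l * dot h f.
Proof.
move=> sym [supp_f _ fE bound] supp_h.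
set b := dform e h f - l * dot h f; set c := dform e h h - l * dot h h.
have c_ge0 : 0 <= c by rewrite subr_ge0 bound.
have quadratic_ge0 t : 0 <= 2 * t * b + t ^+ 2 * c.
  have := bound _ (supported_lin t supp_f supp_h); rewrite -subr_ge0; congr (_ <= _).
  rewrite dform_linl !dform_linr dot_linl !dot_linr.
  by rewrite (dformC f h sym) (dotC f h) /b /c fE; ring.
apply/eqP; rewrite -subr_eq0 -/b; apply: contraT => b_neq0.
have c1_gt0 : 0 < c + 1 by rewrite ltr_wpDl.
have := quadratic_ge0 (- b / (c + 1)).
have -> : 2 * (- b / (c + 1)) * b + (- b / (c + 1)) ^+ 2 * c =
    - (b ^+ 2 * (c + 2) / (c + 1) ^+ 2).
  by field; rewrite gt_eqF.
rewrite oppr_ge0 leNgt divr_gt0 ?exprn_gt0 // mulr_gt0 ?exprn_even_gt0 //.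
by rewrite ltr_wpDl.
Qed.

Lemma ground_state_lap A e l f v : symmetric e -> ground_state A e l f ->
  v \in A -> lap e f v = l * f v.
Proof.
move=> sym ground vA; have supp_v : supported A (indic [set v]).
  by apply: supported_indic; rewrite sub1set.
by have := ground_state_variation sym ground supp_v; rewrite /dform !dot_indic.
Qed.

Lemma ground_state_abs A e l f :
  ground_state A e l f -> ground_state A e l (fun u => `|f u|).
Proof.
move=> [supp_f f_neq0 fE bound].
have dot_abs : dot (fun u => `|f u|) (fun u => `|f u|) = dot f f.
  by apply: eq_bigr => u _; rewrite -!expr2 real_normK ?num_real.
have supp_abs : supported A (fun u => `|f u|) by move=> v vA; rewrite supp_f // normr0.
split; rewrite ?dot_abs //; apply/eqP; rewrite eq_le -{2}dot_abs bound // andbT -fE.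
rewrite /dform /dot /lap; apply: ler_sum => u _; rewrite !mulr_sumr; apply: ler_sum => v _.
case: (e u v); rewrite ?mul0r ?mulr0 // !mul1r !mulrBr -!expr2 real_normK ?num_real //.
by rewrite lerB // -normrM ler_norm.
Qed.

End DirichletForm.

Section Relabelling.
Variables (R : realFieldType) (n : nat) (rho : {perm 'I_n}) (e : rel 'I_n).
Notation V := 'I_n.
Implicit Types (A B : {set V}) (f g : V -> R) (l : R).

Lemma edges_relabel A B :
  edges (relabel rho e) (rho @^-1: A) (rho @^-1: B) = edges e A B.
Proof.
rewrite /edges [RHS](reindex_inj (@perm_inj _ rho)) /=.
apply: eq_big => [u|u _]; rewrite ?inE // [RHS](reindex_inj (@perm_inj _ rho)) /=.
by apply: eq_bigl => v; rewrite inE.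
Qed.

Lemma edges_relabel_initial c b :
  edges (relabel rho e) (initial rho c) (~: initial rho b) =
  edges e (ord_prefix n c) (~: ord_prefix n b).
Proof. by rewrite -edges_relabel preimsetC. Qed.

Lemma interior_relabel : interior (relabel rho e) = rho @^-1: interior e.
Proof.
apply/setP => v; rewrite !inE /deg -[X in _ = (1 < X)](card_preimset _ (@perm_inj _ rho)).
by congr (1 < _); apply: eq_card => w; rewrite !inE.
Qed.

Local Open Scope ring_scope.

Lemma dot_relabel f g : dot (f \o rho) (g \o rho) = dot f g.
Proof. by rewrite /dot [RHS](reindex_inj (@perm_inj _ rho)). Qed.

Lemma dform_relabel f g : dform (relabel rho e) (f \o rho) (g \o rho) = dform e f g.
Proof.
rewrite /dform -[RHS]dot_relabel; congr dot; apply: boolp.funext => u /=.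
by rewrite /lap [RHS](reindex_inj (@perm_inj _ rho)).
Qed.

Lemma rayleigh_bound_relabel A l :
  rayleigh_bound A e l -> rayleigh_bound (rho @^-1: A) (relabel rho e) l.
Proof.
move=> bound g supp_g; have -> : g = (g \o rho^-1%g) \o rho.
  by apply: boolp.funext => u /=; rewrite permK.
rewrite dot_relabel dform_relabel; apply: bound => v vA.
by apply: supp_g; rewrite inE permKV.
Qed.

Lemma ground_state_relabel A l f : ground_state A e l f ->
  ground_state (rho @^-1: A) (relabel rho e) l (f \o rho).
Proof.
case=> supp_f f_neq0 fE bound; split; rewrite ?dot_relabel ?dform_relabel //.
  by move=> v; rewrite inE => /supp_f.
exact: rayleigh_bound_relabel.
Qed.

End Relabelling.

(** * The smallest Dirichlet eigenvalue *)

Section SphereMinimum.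
Import boolp classical_sets topology normedtype derive.
Import numFieldNormedType.Exports.
Variables (R : realType) (n : nat) (A : {set 'I_n}).
Local Open Scope ring_scope.
Local Open Scope classical_set_scope.

Definition supported_sphere : set 'rV[R]_n :=
  [set v | \sum_i v ord0 i ^+ 2 = 1] `&` [set v | supported A (v ord0)].

Lemma continuous_sum (I : finType) (X : topologicalType) (F : I -> X -> R) :
  (forall i, continuous (F i)) -> continuous (fun x => \sum_i F i x).
Proof. by move=> F_cont; apply: continuous_big => //; apply: add_continuous. Qed.

Lemma compact_supported_sphere : compact supported_sphere.
Proof.
apply: bounded_closed_compact.
  exists 1; split; first exact: num_real.
  move=> M M_gt1 v [/= v_unit _]; apply: (@le_trans _ _ 1); last exact: ltW.
  rewrite [`|v|]mx_normrE; apply/bigmax_leP; split=> // -[i j] _ /=.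
  rewrite ord1 -(@expr_le1 _ 2) // real_normK ?num_real // -v_unit (bigD1 j) //=.
  by rewrite lerDl; apply: sumr_ge0 => i' _; exact: sqr_ge0.
apply: closedI.
  apply: (@preimage_closed _ _ (fun v : 'rV[R]_n => \sum_i v ord0 i ^+ 2) [set 1]) => // v _.
  apply: continuous_sum => i w.
  by under eq_fun do rewrite expr2; apply: continuousM; apply: coord_continuous.
suff : closed (\bigcap_(i in [set i | i \notin A]) (fun v : 'rV[R]_n => v ord0 i) @^-1` [set 0]).
  by [].
by apply: closed_bigI => i _; apply: preimage_closed => // v _; apply: coord_continuous.
Qed.

Lemma supported_sphere_neq0 : A != finset.set0 -> supported_sphere !=set0.
Proof.
case/finset.set0Pn=> v vA; exists (delta_mx ord0 v); split=> /= [|u uA].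
  rewrite (bigD1 v) //= mxE !eqxx expr1n big1 ?addr0 // => u /negPf uv.
  by rewrite mxE uv andbF expr0n.
by rewrite mxE eqxx; case: eqP => //= uv; rewrite -uv (negPf uA) in vA.
Qed.

Lemma dform_sphere_min (e : rel 'I_n) : A != finset.set0 -> exists f : 'I_n -> R,
  [/\ supported A f, dot f f = 1 &
      forall g, supported A g -> dot g g = 1 -> dform e f f <= dform e g g].
Proof.
move=> /supported_sphere_neq0 nonempty.
have coord_cont u : continuous (fun v : 'rV[R]_n => v ord0 u).
  exact: coord_continuous.
have lap_cont u : continuous (fun v : 'rV[R]_n => lap e (v ord0) u).
  apply: continuous_sum => w v.
  exact: cvgM (cvg_cst _) (cvgB (coord_cont u v) (coord_cont w v)).
have form_cont : continuous (fun v : 'rV[R]_n => dform e (v ord0) (v ord0)).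
  apply: continuous_sum => u v.
  exact: cvgM (coord_cont u v) (lap_cont u v).
have dotE (v : 'rV[R]_n) : dot (v ord0) (v ord0) = \sum_i v ord0 i ^+ 2.
  by apply: eq_bigr => i _; rewrite expr2.
have [v] := EVT_min_rV nonempty compact_supported_sphere (continuous_subspaceT form_cont).
rewrite inE => -[/= v_unit supp_v] v_min.
exists (v ord0); rewrite dotE; split=> // g supp_g g_unit.
have rowE : (\row_i g i : 'rV[R]_n) ord0 = g by apply: funext => i; rewrite mxE.
have := v_min (\row_i g i); rewrite rowE; apply.
by rewrite inE; split=> /=; rewrite -?dotE rowE.
Qed.

End SphereMinimum.

Section DirichletEigenvalues.
Variables (R : realType) (n : nat) (e : rel 'I_n).
Notation V := 'I_n.
Implicit Types (u v w x y : V) (f g : V -> R) (l m : R) (A : {set V}) (z : 'rV[R]_#|interior e|).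
Local Open Scope ring_scope.

Lemma ground_state_exists A : A != set0 -> exists l f, ground_state A e l f.
Proof.
move=> /(dform_sphere_min R e)[f [supp_f f_unit f_min]].
exists (dform e f f), f; split; rewrite ?f_unit ?mulr1 // => g supp_g.
have [gg0|g_neq0] := eqVneq (dot g g) 0.
  by rewrite gg0 mulr0 /dform /dot big1 // => u _; rewrite (dot_eq0 gg0) mul0r.
have g_gt0 : 0 < dot g g by rewrite lt_neqAle eq_sym g_neq0 dot_ge0.
pose a := (Num.sqrt (dot g g))^-1.
have a2 : a ^+ 2 = (dot g g)^-1 by rewrite exprVn sqr_sqrtr // ltW.
have supp_ag : supported A (fun u => a * g u) by move=> u uA; rewrite supp_g ?mulr0.
have := f_min _ supp_ag; rewrite dot_scale dform_scale a2 mulVf // => /(_ erefl).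
by rewrite mulrC ler_pdivlMr.
Qed.

Hypothesis e_simple : simple_graph e.

Definition zero_extend z x : R :=
  \sum_i z ord0 i * (enum_val i == x)%:R.

Lemma zero_extendE z i : zero_extend z (enum_val i) = z ord0 i.
Proof.
rewrite /zero_extend (bigD1 i) //= eqxx mulr1 big1 ?addr0 // => j ji.
by rewrite (inj_eq enum_val_inj) (negPf ji) mulr0.
Qed.

Lemma zero_extend_supported z : supported (interior e) (zero_extend z).
Proof.
move=> x x_bd; apply: big1 => i _; case: eqP => [xE|]; last by rewrite mulr0.
by move: x_bd; rewrite -xE enum_valP.
Qed.

Lemma supported_zero_extend f : supported (interior e) f ->
  zero_extend (\row_i f (enum_val i)) = f.
Proof.
move=> supp_f; apply: boolp.funext => x; have [x_int|x_bd] := boolP (x \in interior e).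
  by rewrite -(enum_rankK_in x_int x_int) zero_extendE mxE.
by rewrite zero_extend_supported ?supp_f.
Qed.

Lemma mul_dirichlet z j :
  (z *m dirichlet R e) ord0 j = lap e (zero_extend z) (enum_val j).
Proof.
have [sym irr] := e_simple; set y := enum_val j.
rewrite mxE; transitivity (\sum_x zero_extend z x * laplacian R e x y).
  rewrite (bigID [in interior e]) /= [X in _ = _ + X]big1 => [|x]; last first.
    by move/(zero_extend_supported z)->; rewrite mul0r.
  rewrite addr0 [RHS]big_enum_val; apply: eq_bigr => i _.
  by rewrite zero_extendE mxE.
rewrite (bigD1 y) //= mxE eqxx /lap [RHS](bigD1 y) //= (negPf (irr y)) mul0r add0r.
rewrite degE natr_sum (bigD1 y) //= (negPf (irr y)) add0r mulr_sumr -big_split /=.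
apply: eq_bigr => x xy; rewrite mxE (negPf xy) (sym x).
by case: (e y x); rewrite /=; ring.
Qed.

Lemma dirichlet_eigenvalueP l : eigenvalue (dirichlet R e) l <->
  exists f, [/\ supported (interior e) f, exists v, f v != 0 &
               {in interior e, forall v, lap e f v = l * f v}].
Proof.
split=> [/eigenvalueP[v vE v_neq0]|[f [supp_f [x fx] f_eigen]]].
  exists (zero_extend v); split; first exact: zero_extend_supported.
    by have /rV0Pn[i vi] := v_neq0; exists (enum_val i); rewrite zero_extendE.
  move=> x x_int; rewrite -(enum_rankK_in x_int x_int) -mul_dirichlet vE mxE.
  by rewrite zero_extendE.
apply/eigenvalueP; exists (\row_i f (enum_val i)).
  apply/rowP => j; rewrite mul_dirichlet supported_zero_extend // f_eigen ?enum_valP //.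
  by rewrite !mxE.
have x_int : x \in interior e by apply: contraNT fx => /supp_f->.
apply/rV0Pn; exists (enum_rank_in x_int x).
by rewrite mxE (enum_rankK_in x_int x_int).
Qed.

Lemma ground_state_lambda l f : ground_state (interior e) e l f -> is_lambda e l.
Proof.
move=> ground; have [supp_f f_neq0 _ bound] := ground; split.
  apply/dirichlet_eigenvalueP; exists f; split=> //.
    apply/existsP; apply: contraTT f_neq0; rewrite negb_exists => /forallP f0.
    rewrite /dot big1 ?ltxx // => v _; have := f0 v; rewrite negbK => /eqP->.
    exact: mul0r.
  by move=> v; apply: ground_state_lap ground; case: e_simple.
move=> m /dirichlet_eigenvalueP[g [supp_g [v gv] g_eigen]].
rewrite -(ler_pM2r (dot_gt0 gv)); apply: le_trans (bound g supp_g) _.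
rewrite le_eqVlt; apply/orP; left; apply/eqP; rewrite /dform /dot mulr_sumr.
apply: eq_bigr => x _; have [x_int|/supp_g->] := boolP (x \in interior e).
  by rewrite g_eigen //; ring.
by rewrite !mul0r mulr0.
Qed.

Lemma is_lambda_unique l m : is_lambda e l -> is_lambda e m -> l = m.
Proof. by case=> l_ev l_min [m_ev m_min]; apply/eqP; rewrite eq_le l_min ?m_min. Qed.

Lemma is_lambda_ground_state l : interior e != set0 ->
  is_lambda e l -> exists f, ground_state (interior e) e l f.
Proof.
case/ground_state_exists=> m [f ground] /is_lambda_unique/(_ (ground_state_lambda ground)) ->.
by exists f.
Qed.

(* At a zero of a nonnegative ground state, the eigenvalue equation makes the sum of its
   values over the neighbours vanish. *)
Lemma ground_state_zero_adj A l f u w : ground_state A e l f -> (forall v, 0 <= f v) ->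
  u \in A -> f u = 0 -> e u w -> f w = 0.
Proof.
move=> ground f_ge0 uA fu0 euw; have [sym _] := e_simple.
have := ground_state_lap sym ground uA; rewrite fu0 mulr0 /lap.
under eq_bigr do rewrite fu0 sub0r mulrN.
rewrite sumrN => /eqP; rewrite oppr_eq0 => /eqP/psumr_eq0P/(_ w isT).
by rewrite euw mul1r; apply=> v _; rewrite mulr_ge0.
Qed.

Lemma ground_state_gt0 l f : is_tree e -> ground_state (interior e) e l f ->
  (forall v, 0 <= f v) -> forall v, v \in interior e -> 0 < f v.
Proof.
move=> e_is_tree ground f_ge0 v v_int; rewrite lt_neqAle f_ge0 andbT eq_sym; apply/eqP => fv0.
have [par rooted] := tree_rooted v e_is_tree; have par_int := rooted_par_interior rooted v_int.
have [_ eE] := rooted; have [_ f_neq0 _ _] := ground.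
have f0 w : f w = 0.
  apply: (rooted_ind (P := fun w => f w = 0) rooted) w => // w wv f_par.
  apply: (ground_state_zero_adj ground f_ge0 (par_int w wv) f_par).
  by rewrite eE /parent_edge wv eqxx.
by move: f_neq0; rewrite /dot big1 ?ltxx // => u _; rewrite f0 mul0r.
Qed.

End DirichletEigenvalues.

Lemma is_lambda_positive (R : realType) n (e : rel 'I_n) (l : R) :
  tree_with_boundary e -> is_lambda e l ->
  exists2 f, ground_state (interior e) e l f & positive_exactly_on (interior e) f.
Proof.
case=> e_is_tree _ _ int_neq0; have [e_simple _ _] := e_is_tree.
case/(is_lambda_ground_state e_simple int_neq0)=> f /ground_state_abs ground.
exists (fun u => `|f u|)%R => // v; apply/idP/idP; last exact: ground_state_gt0 ground _ _.
by apply: contraLR; case: ground => supp_f _ _ _ /supp_f->; rewrite ltxx.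
Qed.

Lemma is_lambda_bound (R : realType) n (e : rel 'I_n) (l : R) :
  tree_with_boundary e -> is_lambda e l -> rayleigh_bound (interior e) e l.
Proof. by move=> e_tree /(is_lambda_positive e_tree)[f []]. Qed.

Lemma is_lambda_exists (R : realType) n (e : rel 'I_n) : tree_with_boundary e ->
  exists l : R, is_lambda e l.
Proof.
case=> [[e_simple _ _] _ _ /(ground_state_exists R e)[l [f ground]]].
by exists l; apply: ground_state_lambda ground.
Qed.


Lemma simple_relabel n (rho : {perm 'I_n}) (e : rel 'I_n) :
  simple_graph e -> simple_graph (relabel rho e).
Proof. by case=> sym irr; split=> [x y|x]; rewrite /relabel. Qed.

Lemma is_lambda_relabel (R : realType) n (rho : {perm 'I_n}) (e : rel 'I_n) (l : R) :
  tree_with_boundary e -> is_lambda (relabel rho e) l <-> is_lambda e l.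
Proof.
case=> [[e_simple _ _] _ _ int_neq0].
have relabel_lambda (m : R) : is_lambda e m -> is_lambda (relabel rho e) m.
  case/(is_lambda_ground_state e_simple int_neq0)=> f /(ground_state_relabel rho).
  by rewrite -interior_relabel; apply/ground_state_lambda/simple_relabel.
split=> [lam|/relabel_lambda//].
have [m [f /(ground_state_lambda e_simple) lam_m]] := ground_state_exists R e int_neq0.
by rewrite (is_lambda_unique lam (relabel_lambda m lam_m)).
Qed.

(** * Layer-cake comparison *)

Section LayerCake.
Variables (R : realFieldType) (n k : nat) (rho : {perm 'I_n}) (f : 'I_n -> R).
Notation V := 'I_n.
Hypotheses (k_lt : (k < n)%N) (anti : antitone f rho).
Hypothesis f_tail : forall v, (k <= rho v)%N -> f v = 0%R.
Implicit Types (e : rel V) (u v w : V) (g : V -> R).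
Local Open Scope ring_scope.

Definition sorted_value c : R := oapp (f \o rho^-1%g) 0 (insub c).

Definition drop_after c : R := sorted_value c - sorted_value c.+1.

Lemma sorted_valueE v : sorted_value (rho v) = f v.
Proof. by rewrite /sorted_value valK /= permK. Qed.

Lemma drop_afterE u v : rho v = (rho u).+1 :> nat -> drop_after (rho u) = f u - f v.
Proof. by move=> uv; rewrite /drop_after -uv !sorted_valueE. Qed.

Lemma consecutive_vertices c : (c < k)%N ->
  exists u v, rho u = c :> nat /\ rho v = c.+1 :> nat.
Proof.
move=> ck; have c1n : (c.+1 < n)%N by apply: leq_ltn_trans k_lt.
by exists (rho^-1%g (Ordinal (ltnW c1n))), (rho^-1%g (Ordinal c1n)); rewrite !permKV.
Qed.

Lemma drop_after_ge0 c : (c < k)%N -> 0 <= drop_after c.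
Proof.
case/consecutive_vertices=> u [v [<- vE]].
by rewrite (drop_afterE vE) subr_ge0; apply: anti; rewrite vE.
Qed.

Lemma drop_after_gt0 c : (c < k)%N -> superlevel f (initial rho c.+1) -> 0 < drop_after c.
Proof.
case/consecutive_vertices=> u [v [<- vE]] sup.
by rewrite (drop_afterE vE) subr_gt0; apply: sup; rewrite in_initial ?vE ?ltnn.
Qed.

Lemma layer_cake : f = fun v => \sum_(c < k) drop_after c * indic R (initial rho c.+1) v.
Proof.
apply: boolp.funext => v.
have tail_k : sorted_value k = 0.
  rewrite -[k]/(Ordinal k_lt : nat) -[Ordinal k_lt](permKV rho) sorted_valueE.
  by rewrite f_tail // permKV.
transitivity (\sum_(rho v <= c < k) drop_after c); last first.
  rewrite (big_nat_widenl _ 0) // big_mkord big_mkcond /=; apply: eq_bigr => c _.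
  by rewrite /indic in_initial ltnS; case: leqP; rewrite ?mulr1 ?mulr0.
have [vk|kv] := ltnP (rho v) k; last first.
  by rewrite big_geq // f_tail.
rewrite (telescope_sumr_eq (fun c => - sorted_value c)); [|exact: ltnW|]; last first.
  by move=> c _; rewrite /drop_after opprK addrC.
by rewrite tail_k sorted_valueE oppr0 opprK add0r.
Qed.

Lemma dform_layers e g :
  dform e g f = \sum_(c < k) drop_after c * dform e g (indic R (initial rho c.+1)).
Proof. by rewrite {1}layer_cake dform_sumr. Qed.

Section Comparison.
Variables e e' : rel V.
Hypotheses (sym : symmetric e) (sym' : symmetric e').
Hypothesis edges_le : forall c b, (0 < c)%N -> (c <= b <= k)%N ->
  (edges e' (initial rho c) (~: initial rho b) <= edges e (initial rho c) (~: initial rho b))%N.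

Lemma dform_indic_initial_le c b : (0 < c <= k)%N -> (0 < b <= k)%N ->
  dform e' (indic R (initial rho c)) (indic R (initial rho b)) <=
  dform e (indic R (initial rho c)) (indic R (initial rho b)).
Proof.
wlog cb : c b / (c <= b)%N => [wlog_le|] c_range b_range.
  have [cb|/ltnW bc] := leqP c b; first exact: wlog_le.
  by rewrite dformC // [leRHS]dformC //; apply: wlog_le.
by rewrite !dform_indic ?initialS // ler_nat edges_le //; lia.
Qed.

Lemma layer_indic_le c (b : 'I_k) : (0 < c <= k)%N ->
  drop_after b * dform e' (indic R (initial rho c)) (indic R (initial rho b.+1)) <=
  drop_after b * dform e (indic R (initial rho c)) (indic R (initial rho b.+1)).
Proof. by move=> ck; rewrite ler_wpM2l ?drop_after_ge0 // dform_indic_initial_le /=. Qed.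

Lemma dform_initial_le c : (0 < c <= k)%N ->
  dform e' (indic R (initial rho c)) f <= dform e (indic R (initial rho c)) f.
Proof. by move=> ck; rewrite !dform_layers; apply: ler_sum => b _; apply: layer_indic_le. Qed.

Lemma dform_le : dform e' f f <= dform e f f.
Proof.
rewrite !(dform_layers _ f); apply: ler_sum => c _.
rewrite ler_wpM2l ?drop_after_ge0 // dformC // [leRHS]dformC //.
by apply: dform_initial_le => /=.
Qed.

Lemma edges_initial_eq c b :
  dform e' (indic R (initial rho c)) f = dform e (indic R (initial rho c)) f ->
  (0 < c)%N -> (c <= b <= k)%N -> superlevel f (initial rho b) ->
  edges e' (initial rho c) (~: initial rho b) = edges e (initial rho c) (~: initial rho b).
Proof.
move=> form_eq c_gt0 /andP[cb bk]; have b_gt0 : (0 < b)%N := leq_trans c_gt0 cb.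
case: b b_gt0 bk cb => // b _ bk cb sup; have ck := leq_trans cb bk.
have diff_ge0 (j : 'I_k) : true -> 0 <=
    drop_after j * dform e (indic R (initial rho c)) (indic R (initial rho j.+1)) -
    drop_after j * dform e' (indic R (initial rho c)) (indic R (initial rho j.+1)).
  by rewrite subr_ge0 layer_indic_le ?c_gt0.
move: form_eq; rewrite !dform_layers => /esym/eqP; rewrite -subr_eq0 -sumrB => /eqP.
move/(psumr_eq0P diff_ge0)/(_ (Ordinal bk) isT)/eqP; rewrite /= -mulrBr mulf_eq0.
rewrite gt_eqF ?drop_after_gt0 //= subr_eq0 !dform_indic ?initialS // eqr_nat.
by move/eqP.
Qed.

End Comparison.
End LayerCake.

(** * Comparison with the canonical tree *)

Lemma positive_superlevel (R : realFieldType) n (A : {set 'I_n}) (f : 'I_n -> R) :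
  positive_exactly_on A f -> superlevel f A.
Proof. by move=> f_gt0 u v; rewrite -!f_gt0 -leNgt => fu fv; apply: le_lt_trans fu. Qed.

Section CanonicalComparison.
Variables (R : realFieldType) (n k d : nat) (e : rel 'I_n).
Variables (f : 'I_n -> R) (rho : {perm 'I_n}).
Notation V := 'I_n.
Hypotheses (d_ge2 : 2 <= d) (e_class : in_class k d e).
Hypotheses (f_gt0 : positive_exactly_on (interior e) f).
Hypotheses (f_supp : supported (interior e) f) (anti : antitone f rho).

Notation sorted_canon := (relabel rho (canon n k d)).

Let adm : admissible n k d := class_admissible d_ge2 e_class.
Let k_lt : k < n := admissible_ltn adm.

Lemma interior_initial : interior e = initial rho k.
Proof.
have [_ card_int _] := e_class; rewrite -card_int.
exact: superlevel_prefix anti (positive_superlevel f_gt0).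
Qed.

Let f_tail v : k <= rho v -> f v = 0%R.
Proof. by move=> kv; apply: f_supp; rewrite interior_initial in_initial -leqNgt. Qed.

Lemma canon_edges_le c b : 0 < c -> c <= b <= k ->
  edges sorted_canon (initial rho c) (~: initial rho b) <=
  edges e (initial rho c) (~: initial rho b).
Proof.
move=> c_gt0 /andP[cb bk]; have [e_tree _ _] := e_class.
have [canon_tree _ _] := canon_in_class adm.
rewrite edges_relabel_initial.
have cards m : m <= k -> #|initial rho m| = m.
  by move=> mk; rewrite card_initial // (leq_trans mk (ltnW k_lt)).
have [ck|kc] := ltnP c k; last first.
  have [-> ->] : c = k /\ b = k by lia.
  rewrite -interior_initial interior_boundary_edges // -(canon_interior adm).
  rewrite interior_boundary_edges // interior_initial canon_interior //.
  by rewrite card_initial ?card_ord_prefix ?(ltnW k_lt).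
rewrite canon_edges_out ?c_gt0 ?cb //.
have := @edges_out_ge _ _ _ _ e_class (initial rho b) (initial rho c).
rewrite -card_gt0 interior_initial !initialS // !cards //; last exact: leq_trans bk.
by move/(_ c_gt0 isT isT); lia.
Qed.

Lemma sorted_canon_sym : symmetric sorted_canon.
Proof. by case: (simple_relabel rho (class_simple (canon_in_class adm))). Qed.

Lemma canon_dform_le : (dform sorted_canon f f <= dform e f f)%R.
Proof.
have [sym _] := class_simple e_class.
exact: (dform_le k_lt anti f_tail sym sorted_canon_sym canon_edges_le).
Qed.

Lemma sorted_canon_bound (l : R) :
  rayleigh_bound (interior (canon n k d)) (canon n k d) l ->
  rayleigh_bound (interior e) sorted_canon l.
Proof.
by move/(rayleigh_bound_relabel (rho := rho)); rewrite canon_interior // interior_initial.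
Qed.

Lemma canon_edges_eq (l : R) c b : ground_state (interior e) e l f ->
  rayleigh_bound (interior (canon n k d)) (canon n k d) l ->
  0 < c -> c <= b <= k -> superlevel f (initial rho b) ->
  edges sorted_canon (initial rho c) (~: initial rho b) =
  edges e (initial rho c) (~: initial rho b).
Proof.
move=> ground /sorted_canon_bound bound c_gt0 cbk sup; have [_ f_neq0 fE _] := ground.
have [sym _] := class_simple e_class.
have gs_canon : ground_state (interior e) sorted_canon l f.
  by split=> //; apply/eqP; rewrite eq_le -{1}fE canon_dform_le bound.
have supp_c : supported (interior e) (indic R (initial rho c)).
  by apply: supported_indic; rewrite interior_initial initialS //; lia.
apply: (edges_initial_eq k_lt anti f_tail sym sorted_canon_sym canon_edges_le) => //.
rewrite (ground_state_variation sorted_canon_sym gs_canon) //.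
by rewrite (ground_state_variation sym ground).
Qed.

End CanonicalComparison.

Lemma canon_lambda_le (R : realType) (n k d : nat) (e : rel 'I_n) (l l' : R) :
  2 <= d -> in_class k d e -> is_lambda (canon n k d) l -> is_lambda e l' -> (l <= l')%R.
Proof.
move=> d_ge2 e_class lam lam'; have [e_tree _ _] := e_class.
have adm := class_admissible d_ge2 e_class.
have [canon_tree _ _] := canon_in_class adm; have bound := is_lambda_bound canon_tree lam.
have [f [f_supp f_neq0 fE _] f_gt0] := is_lambda_positive e_tree lam'.
have [rho anti _] := sorting_perm (superlevel_upper (positive_superlevel f_gt0)).
rewrite -(ler_pM2r f_neq0) -fE.
apply: le_trans (canon_dform_le d_ge2 e_class f_gt0 f_supp anti).
exact: (sorted_canon_bound d_ge2 e_class f_gt0 anti bound).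
Qed.

(** * Breadth-first orders *)

Section BreadthFirstOrder.
Variables (n : nat) (e : rel 'I_n) (r : 'I_n) (par : 'I_n -> 'I_n) (rho : {perm 'I_n}).
Hypothesis rooted : rooted_at e r par (height e r).
Notation V := 'I_n.
Implicit Types (u v w : V).

(* The positions of the vertices on the path from the root to [v], read as digits in base
   [n + 1]; the root is omitted and digits are at least 1, so longer paths get larger codes. *)
Definition bfs_code v : nat := \sum_(i < height e r v) (rho (iter i par v)).+1 * n.+1 ^ i.

Lemma bfs_code_root : bfs_code r = 0.
Proof. by rewrite /bfs_code (rooted_height_root rooted) big_ord0. Qed.

Lemma bfs_code_par v : v != r -> bfs_code v = bfs_code (par v) * n.+1 + (rho v).+1.
Proof.
move=> vr; rewrite /bfs_code (rooted_height rooted vr) big_ord_recl muln1 addnC big_distrl /=.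
by congr (_ + _); apply: eq_bigr => i _; rewrite -iterSr expnSr mulnA.
Qed.

Lemma bfs_code_eq0 v : (bfs_code v == 0) = (v == r).
Proof.
by have [->|vr] := eqVneq v r; rewrite ?bfs_code_root // bfs_code_par // addnS.
Qed.

Lemma bfs_code_mod v : v != r -> bfs_code v %% n.+1 = (rho v).+1.
Proof. by move=> vr; rewrite bfs_code_par // modnMDl modn_small ?ltnS. Qed.

Lemma bfs_code_inj : injective bfs_code.
Proof.
move=> u v codeE; have [ur|ur] := eqVneq u r.
  by apply/esym/eqP; rewrite ur -bfs_code_eq0 -codeE ur bfs_code_root.
have vr : v != r by rewrite -bfs_code_eq0 -codeE bfs_code_eq0.
by apply/(@perm_inj _ rho)/val_inj/succn_inj; rewrite -!bfs_code_mod // codeE.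
Qed.

Lemma bfs_code_par_lt u v : u != r -> v != r ->
  bfs_code (par u) < bfs_code (par v) -> bfs_code u < bfs_code v.
Proof.
move=> ur vr code_lt; rewrite (bfs_code_par ur) (bfs_code_par vr).
have := leq_mul code_lt (leqnn n.+1); have := ltn_ord (rho u); rewrite mulSn.
by lia.
Qed.

Lemma bfs_code_siblings u v : u != r -> v != r -> par u = par v ->
  (bfs_code u < bfs_code v) = (rho u < rho v).
Proof. by move=> ur vr parE; rewrite (bfs_code_par ur) (bfs_code_par vr) parE ltn_add2l. Qed.

Lemma bfs_code_height u v : bfs_code u < bfs_code v -> height e r u <= height e r v.
Proof.
apply: contraTT; rewrite -ltnNge -leqNgt; move: u.
apply: (rooted_ind (P := fun v => forall u, height e r v < height e r u ->
  bfs_code v <= bfs_code u) rooted) v => [u _|v vr IH u]; first by rewrite bfs_code_root.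
have [->|ur] := eqVneq u r; first by rewrite (rooted_height_root rooted).
rewrite (rooted_height rooted vr) (rooted_height rooted ur) ltnS => height_lt.
have := IH _ height_lt; rewrite leq_eqVlt => /orP[/eqP/bfs_code_inj parE|code_lt].
  by rewrite parE ltnn in height_lt.
exact/ltnW/bfs_code_par_lt.
Qed.

End BreadthFirstOrder.

(** * Trees attaining the minimum *)

Section ExtremalTrees.
Variables (R : realFieldType) (n k d : nat) (e : rel 'I_n) (l : R) (f : 'I_n -> R).
Notation V := 'I_n.
Hypotheses (d_ge2 : 2 <= d) (e_class : in_class k d e).
Hypothesis ground : ground_state (interior e) e l f.
Hypothesis f_gt0 : positive_exactly_on (interior e) f.
Hypothesis canon_bound : rayleigh_bound (interior (canon n k d)) (canon n k d) l.
Implicit Types (u v w x y : V) (A C : {set V}) (t : R).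

Let adm : admissible n k d := class_admissible d_ge2 e_class.

Let f_boundary v : v \notin interior e -> f v = 0%R.
Proof. by case: ground => f_supp _ _ _ /f_supp. Qed.

Let f_ge0 v : (0 <= f v)%R.
Proof.
have [v_int|/f_boundary->//] := boolP (v \in interior e).
by rewrite ltW // f_gt0.
Qed.

(* When [d * #|C| + 2 < #|A| + #|C|], the bound [edges_out_ge] is void and not attained. *)
Lemma upper_tight A C : C != set0 -> C \subset A -> A \subset interior e ->
  upper_set f C -> superlevel f A -> #|C| < k ->
  (#|A| + #|C| <= d * #|C| + 2) || (0 < edges e C (~: A)) -> tight d e C A.
Proof.
move=> C_neq0 sCA sA upC supA ck; have [_ card_int _] := e_class; have [f_supp _ _ _] := ground.
have [rho anti CE] := sorting_perm upC; have AE := superlevel_prefix anti supA.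
have c_gt0 : 0 < #|C| by rewrite card_gt0.
have cak : #|C| <= #|A| <= k by rewrite -card_int !subset_leq_card.
have edgesE : edges e C (~: A) = d * #|C| + 2 - (#|A| + #|C|).
  rewrite -(canon_edges_out adm) ?c_gt0 // -(edges_relabel_initial rho) {1}CE {1}AE.
  apply/esym/(canon_edges_eq d_ge2 e_class f_gt0 f_supp anti ground canon_bound) => //.
  by rewrite -AE.
by rewrite /tight edgesE /=; lia.
Qed.

Definition at_least t : {set V} := [set v | (t <= f v)%R].

Lemma at_least_superlevel t : superlevel f (at_least t).
Proof. by move=> u v; rewrite !inE -ltNge => tu vt; apply: lt_le_trans tu. Qed.

Lemma at_least_interior t : (0 < t)%R -> at_least t \subset interior e.
Proof. by move=> t_gt0; apply/subsetP => v; rewrite inE -f_gt0; apply: lt_le_trans. Qed.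

Lemma interior_degree z : z \in interior e -> (forall y, y \in interior e -> (f z <= f y)%R) ->
  forall v, v \in interior e -> v != z -> deg e v = d.
Proof.
move=> z_int z_min v v_int vz; have [_ card_int _] := e_class.
pose C := interior e :\ z; have vC : v \in C by rewrite in_setD1 vz.
have sC : C \subset interior e by apply: subsetDl.
have card_C : k = #|C|.+1 by rewrite -card_int (cardsD1 z) z_int.
have upC : upper_set f C.
  move=> x y xC; rewrite in_setD1 negb_and negbK => /orP[/eqP->|y_bd].
    exact/z_min/(subsetP sC).
  by rewrite (f_boundary y_bd) f_ge0.
suff tightC : tight d e C (interior e) by apply: (tight_degree e_class sC _ tightC vC).
apply: upper_tight => //; [by apply/set0Pn; exists v | | by rewrite card_C |].
  exact: positive_superlevel.
by rewrite card_int card_C; have := leq_mul2r #|C| 2 d; rewrite d_ge2 orbT /=; lia.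
Qed.

Variables (r : V) (par : V -> V).
Hypothesis r_max : forall v, (f v <= f r)%R.
Hypothesis rooted : rooted_at e r par (height e r).

Lemma root_interior : r \in interior e.
Proof.
have [[_ _ _ /set0Pn[y y_int]] _ _] := e_class.
by rewrite -f_gt0; apply: lt_le_trans (r_max y); rewrite f_gt0.
Qed.

Let par_int := rooted_par_interior rooted root_interior.

Lemma weight_par v : v != r -> (f v <= f (par v))%R.
Proof.
move=> vr; have [v_int|v_bd] := boolP (v \in interior e); last first.
  by rewrite (f_boundary v_bd) f_ge0.
have [_ card_int _] := e_class; pose A := at_least (f v).
have vA : v \in A by rewrite inE.
have rA : r \in A by rewrite inE.
have sA : A \subset interior e by rewrite at_least_interior ?f_gt0.
suff : par v \in A by rewrite inE.
have [A_int|A_small] := eqVproper sA; first by rewrite A_int par_int.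
apply: (tight_parent e_class rooted rA (subxx A) sA) => //.
apply: upper_tight => //; [by apply/set0Pn; exists v | | | |].
- exact/superlevel_upper/at_least_superlevel.
- exact: at_least_superlevel.
- by rewrite -card_int proper_card.
- by have := leq_mul2r #|A| 2 d; rewrite d_ge2 orbT /=; lia.
Qed.

(* Otherwise the vertices above [par w2], with the root and [par w1], form a set joined by an
   edge to the complement of [at_least (f w2)]; tightness would put [par w2] in that set. *)
Lemma weight_children w1 w2 : w1 != r -> w2 != r -> par w1 != par w2 -> par w2 != r ->
  (f (par w2) <= f (par w1))%R -> (f w2 <= f w1)%R.
Proof.
move=> w1r w2r par_neq par2r par_le; rewrite leNgt; apply/negP => w12.
have [_ card_int _] := e_class; pose v := par w2.
pose C := [set x | (f v < f x)%R] :|: [set r; par w1]; pose A := at_least (f w2).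
have C_ge x : x \in C -> (f v <= f x)%R.
  by rewrite !inE => /orP[/ltW//|/orP[]/eqP->].
have vC : v \notin C by rewrite !inE ltxx /= negb_or par2r eq_sym.
have rC : r \in C by rewrite !inE eqxx orbT.
have par1C : par w1 \in C by rewrite !inE eqxx !orbT.
have w2A : w2 \in A by rewrite inE.
have sCA : C \subset A.
  by apply/subsetP => x /C_ge vx; rewrite inE; apply: le_trans (weight_par w2r) vx.
have sA : A \subset interior e by apply/at_least_interior/(le_lt_trans (f_ge0 w1)).
apply: (negP vC); apply: (tight_parent e_class rooted rC sCA sA _ w2A w2r).
apply: upper_tight => //; [by apply/set0Pn; exists r | | | |].
- move=> x y /C_ge vx; rewrite !inE negb_or -leNgt => /andP[yv _].
  exact: le_trans vx.
- exact: at_least_superlevel.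
- rewrite -card_int proper_card // properE (subset_trans sCA sA) /=.
  by apply/subsetPn; exists v => //; apply: par_int.
apply/orP; right; rewrite /edges (bigD1 (par w1)) //= (bigD1 w1) /=; last by rewrite !inE -ltNge.
by have [_ ->] := rooted; rewrite /parent_edge w1r eqxx.
Qed.

Variable rho : {perm V}.
Hypothesis anti : antitone f rho.

Notation code := (bfs_code e r par rho).

Lemma bfs_code_antitone u v : code u < code v -> (f v <= f u)%R.
Proof.
move: u; apply: (rooted_ind (P := fun v => forall u, code u < code v -> (f v <= f u)%R) rooted) v.
  by move=> u; rewrite bfs_code_root.
move=> v vr IH u uv; have [->//|ur] := eqVneq u r.
have [par_lt|par_gt|/bfs_code_inj parE] := ltngtP (code (par u)) (code (par v)).
- apply: weight_children ur vr _ _ (IH _ par_lt).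
    by apply: contraTneq par_lt => ->; rewrite ltnn.
  by rewrite -(bfs_code_eq0 rho rooted); lia.
- by have := bfs_code_par_lt rooted vr ur par_gt; lia.
- by apply: anti; rewrite ltnW // -(bfs_code_siblings rho rooted ur vr (parE rooted)).
Qed.

Lemma bfs_SLOstar z : z \in interior e -> (forall y, y \in interior e -> (f z <= f y)%R) ->
  SLOstar e r (fun u v => code u < code v).
Proof.
move=> z_int z_min; have [e_tree _ dmin] := e_class; split; first split.
- exact: (strict_total_order_inj (bfs_code_inj rooted)).
- exact: bfs_code_height.
- move=> u v w1 w2 uv; rewrite !(rooted_child rooted).
  case/andP=> w1r /eqP u_par /andP[w2r /eqP v_par].
  by apply: bfs_code_par_lt; rewrite ?u_par ?v_par.
- move=> v w /bfs_code_antitone; rewrite !interiorNboundary // => fwv /f_boundary fv.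
  by rewrite -f_gt0 -leNgt -fv.
move=> v w v_int w_int vw.
suff -> : deg e v = d by apply: dmin.
have [vz|] := eqVneq v z; last exact: (interior_degree z_int z_min).
apply: (interior_degree w_int) => // [y y_int|].
  by apply: le_trans (z_min y y_int); rewrite -vz bfs_code_antitone.
by apply: contraTneq vw => ->; rewrite ltnn.
Qed.

End ExtremalTrees.

Lemma lambda_eq_canon_SLOstar (R : realType) (n k d : nat) (e : rel 'I_n) (l : R) :
  2 <= d -> in_class k d e -> is_lambda e l -> is_lambda (canon n k d) l ->
  SLOstar_tree e /\ extremal_degrees d e.
Proof.
move=> d_ge2 e_class lam lamT; have [e_tree _ dmin] := e_class.
have [_ _ _ /set0Pn[y y_int]] := e_tree.
have [canon_tree _ _] := canon_in_class (class_admissible d_ge2 e_class).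
have bound := is_lambda_bound canon_tree lamT.
have [f ground f_gt0] := is_lambda_positive e_tree lam.
have [r _ r_ge] := arg_maxP (P := predT) f (i0 := y) isT.
have [z z_int z_min] := arg_minP f y_int.
have [rho anti _] := sorting_perm (superlevel_upper (positive_superlevel f_gt0)).
have [par rooted] := class_rooted e_class r.
split.
  split=> //; exists r, (fun u v => bfs_code e r par rho u < bfs_code e r par rho v).
  have r_max v : (f v <= f r)%R by apply: r_ge.
  exact: (bfs_SLOstar d_ge2 e_class ground f_gt0 bound r_max rooted anti z_int z_min).
have deg_z := interior_degree d_ge2 e_class ground f_gt0 bound z_int z_min.
exists z => //; split=> //; rewrite (bigD1 z) //= big1 => [|v /andP[v_int vz]].
  by rewrite addn0 subnKC // dmin.
by rewrite deg_z ?subnn.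
Qed.

Lemma faber_krahn_canon (R : realType) (n k d : nat) (e : rel 'I_n) :
  2 <= d -> in_class k d e ->
  faber_krahn R k d e <-> (forall l : R, is_lambda e l -> is_lambda (canon n k d) l).
Proof.
move=> d_ge2 e_class; have canon_class := canon_in_class (class_admissible d_ge2 e_class).
split=> [fk l lam|lamT e' e'_class l l' /lamT]; last exact: canon_lambda_le.
have [canon_tree _ _] := canon_class; have [m lamT] := is_lambda_exists R canon_tree.
suff <- : m = l by [].
by apply/le_anti; rewrite (canon_lambda_le d_ge2 e_class lamT lam) (fk _ canon_class l).
Qed.

Theorem theorem2 (R : realType) (n k d : nat) :
  1 <= k -> k <= n - 1 -> 2 <= d ->
  (forall e : rel 'I_n, in_class k d e ->
     (faber_krahn R k d e <-> (SLOstar_tree e /\ extremal_degrees d e))) /\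
  (forall e e' : rel 'I_n, in_class k d e -> in_class k d e' ->
     SLOstar_tree e -> extremal_degrees d e ->
     SLOstar_tree e' -> extremal_degrees d e' -> graph_iso e e').
Proof.
move=> _ _ d_ge2; split=> [e e_class|e e' e_class e'_class slo ext slo' ext']; last first.
  have [rho eE] := SLOstar_tree_canon d_ge2 e_class slo ext.
  have [rho' eE'] := SLOstar_tree_canon d_ge2 e'_class slo' ext'.
  by exists (rho * rho'^-1)%g => x y; rewrite eE eE' /relabel !permM !permKV.
rewrite faber_krahn_canon //; have [e_tree _ _] := e_class.
split=> [lamT|[slo ext] l lam].
  have [l lam] := is_lambda_exists R e_tree.
  exact: lambda_eq_canon_SLOstar d_ge2 e_class lam (lamT l lam).
have [rho eE] := SLOstar_tree_canon d_ge2 e_class slo ext.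
have [canon_tree _ _] := canon_in_class (class_admissible d_ge2 e_class).
by apply/(is_lambda_relabel rho l canon_tree); rewrite -eE.
Qed.
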